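(* There exist a function $\omega:\mathbf{N}\to(0,\infty)$ with $\omega(n)\to\infty$ as $n\to\infty$ and an absolute constant $c>0$ with $\omega(n)\geqslant c\,\frac{\sqrt{\log\log\log n}}{\log\log\log\log n}$ for all sufficiently large $n$, such that the following holds. Let $G$ be a finite abelian group with $|G|>1$ and let $p(G)$ be the smallest prime factor of $|G|$. If $A\subset G$ has no unique sum, then $$|A|\geqslant \omega(p(G))\log p(G).$$
   Context: Let $G$ be an abelian group and $A\subset G$. We say that $A$ has a unique sum if there exist $a_1,a_2\in A$ such that the only solutions $(x,y)\in A^2$ of $x+y=a_1+a_2$ are $(x,y)=(a_1,a_2)$ and $(x,y)=(a_2,a_1)$.
   Formalization: The set A is assumed nonempty: the empty set has no unique sum under the definition, yet |A| = 0 is less than ω(p(G)) log p(G) > 0, so the claim fails for it as written. *)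

(* Defs.v *)
From mathcomp Require Import all_boot all_order all_algebra.
From Stdlib Require Import Reals.
Set Implicit Arguments. Unset Strict Implicit. Unset Printing Implicit Defensive.
Import GRing.Theory.

Definition has_unique_sum (G : finZmodType) (A : {set G}) : Prop :=
  exists a1 a2 : G, a1 \in A /\ a2 \in A /\
    forall x y : G, x \in A -> y \in A -> GRing.add x y = GRing.add a1 a2 ->
      (x = a1 /\ y = a2) \/ (x = a2 /\ y = a1).

Definition pG (G : finZmodType) : nat := pdiv #|G|.

(* Main.v *)
Require Import Defs.
From mathcomp Require Import zify ring.
From mathcomp Require Import all_boot all_order all_algebra.
From mathcomp Require Import all_fingroup all_solvable all_field all_character.

(** Let n = |A| and p = p(G).  If every element of A is a combination of l1-norm at
    most L of elements of S and (4L+1)^|S| < p, then Dirichlet's pigeonhole argument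
    on multiples of a character makes A linearly orderable in a suitable sense, and an
    extremal x in A has a unique sum x + x.  So it suffices to span A with bounded norm
    by a set S of size O(n/K), where K is about log n.

    Take S to be a sparse colour class of a random K-colouring of A.  For x in A, either
    the relations x + a = b + c contain M disjoint triples (a,b,c), and S contains one of
    them and so spans x with norm 3, or a set W of at most 3M elements meets them all,
    so that almost every a in A has a + x - t in A for some t in W.  Call a difference
    rich if it is attained by M disjoint pairs; S spans rich differences with norm 2.
    Join x and t when x - t is rich.  Balls of radius K with more than K elements are
    covered, at distance 2K, by at most n/K centres.  A smaller ball is a connected
    component; it is spanned through any of its elements of the first kind.  If some small
    component C has none, let x be an extremal element of C: then all but O(M^2) elements
    a of A can be moved along an edge to a + x - t with t in C.  Iterating this inside a
    small component would close up to a vanishing sum of differences x - t, contradicting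
    extremality; so every small component contains one of the O(M^2) exceptional elements,
    which are added to S. *)

Set Implicit Arguments. Unset Strict Implicit. Unset Printing Implicit Defensive.
Import Order.TTheory GRing.Theory Num.Theory.

(** * Characters, spans of bounded norm, and extremal points *)

Section Extremal.
Local Open Scope ring_scope.
Variable G : finZmodType.

(** Irreducible characters of an abelian group are linear and their kernels meet trivially. Their
    values are powers of one primitive root of unity of order [#|G|], and [h] is the exponent. *)
Lemma separating_hom (g : G) : g != 0 ->
  exists h : G -> nat,
    (forall x y, h (x + y) = (h x + h y)%N %[mod #|G|]) /\ ~~ (#|G| %| h g)%N.
Proof.
move=> g0; pose T := [set: G]%G.
have cT : #|T| = #|G| by rewrite cardsT.
have gN : g \notin \bigcap_i cfker 'chi[T]_i.
  by rewrite TI_cfker_irr inE.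
have [i gi] : exists i, g \notin cfker 'chi[T]_i.
  apply/existsP; apply: contraR gN; rewrite negb_exists => /forallP gN.
  by apply/bigcapP => i _; move: (gN i); rewrite negbK.
have lin : 'chi[T]_i \is a linear_char.
  by apply: char_abelianP; apply: FinRing.zmod_abelian.
have N0 : (0 < #|G|)%N by rewrite -cT cardG_gt0.
have [z zP] := cyclotomic.C_prim_root_exists N0.
have root x : exists k : nat, 'chi[T]_i x = z ^+ k.
  have : 'chi[T]_i x ^+ #|G| = 1.
    have /dvdnP[k ->] : (#[x]%g %| #|G|)%N by rewrite -cT order_dvdG ?inE.
    by rewrite mulnC exprM lin_char_unity_root ?inE // expr1n.
  by move/(prim_rootP zP) => [k ->]; exists k.
have [h hP] := fin_all_exists root.
exists h; split=> [x y|].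
  apply/eqP; rewrite -(eq_prim_root_expr zP) exprD -!hP -lin_charM ?inE //.
apply: contra gi; rewrite cfkerEirr inE lin_char1 // hP.
by rewrite -(prim_order_dvd zP).
Qed.

Definition additive_mod (N : nat) (f : G -> int) :=
  forall x y, (N%:Z %| f (x + y) - (f x + f y))%Z.

(** Dirichlet's pigeonhole: sort the multiples [l * h] with [l < pG G] by which of [Q] intervals
    modulo [#|G|] holds each value on [S]. Two of them agree, and their difference is small on [S].
    It still separates [g], since [0 < l - l' < pG G] makes [l - l'] coprime to [#|G|]. *)
Lemma small_separating_hom (S : {set G}) (Q : nat) (g : G) :
  (0 < Q)%N -> (Q ^ #|S| < pG G)%N -> g != 0 ->
  exists f : G -> int, [/\ additive_mod #|G| f,
    forall s, s \in S -> `|f s| * Q%:Z < #|G|%:Z & ~~ (#|G|%:Z %| f g)%Z].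
Proof.
move=> Q0 QS g0; have [h [hD hg]] := separating_hom g0.
set N := #|G| in hD hg *.
have N0 : (0 < N)%N by apply/card_gt0P; exists g.
pose r (l : nat) x := (l * h x %% N)%N.
have rN l x : (r l x < N)%N by rewrite ltn_mod.
have box l x : (Q * r l x %/ N < Q)%N by rewrite ltn_divLR // ltn_mul2l Q0 rN.
pose F (l : 'I_(pG G)) := [ffun s : {s | s \in S} => Ordinal (box l (val s))].
have /injectivePn [l [l' ll' Fll']] : ~~ injectiveb F.
  apply/injectiveP => /leq_card; rewrite card_ffun !card_ord card_sig leqNgt.
  by move/negP; apply; rewrite cardE -cardE.
exists (fun x => (r l x)%:Z - (r l' x)%:Z); split.
- move=> x y.
  have H k : (N%:Z %| (r k (x + y)%R)%:Z - ((r k x)%:Z + (r k y)%:Z))%Z.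
    have : r k (x + y)%R = (r k x + r k y)%N %[mod N].
      by rewrite /r modn_mod modnDm -mulnDr -modnMmr hD modnMmr.
    by move/eqP; rewrite -eqz_mod_dvd -PoszD !modz_nat eqz_nat.
  have -> : (r l (x + y))%:Z - (r l' (x + y))%:Z - ((r l x)%:Z - (r l' x)%:Z + ((r l y)%:Z - (r l' y)%:Z))
     = ((r l (x + y))%:Z - ((r l x)%:Z + (r l y)%:Z)) - ((r l' (x + y))%:Z - ((r l' x)%:Z + (r l' y)%:Z)) by ring.
  exact: rpredB (H l) (H l').
- move=> s sS; have /ffunP/(_ (Sub s sS)) := Fll'; rewrite !ffunE /= => -[].
  move: (r l s) (r l' s) => a b; have := divn_eq (Q * a) N; have := divn_eq (Q * b) N.
  have := ltn_pmod (Q * a) N0; have := ltn_pmod (Q * b) N0 => h1 h2 h3 h4 h5.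
  rewrite h5 in h4.
  nia.
- rewrite -eqz_mod_dvd /r !modz_nat !modn_mod eqz_nat.
  wlog ltl : l l' ll' {Fll'} / (l' < l)%N.
    move=> W; case: (ltngtP l l') => [?|?|/val_inj e]; last by rewrite e eqxx in ll'.
    - by rewrite eq_sym; apply: W => //; rewrite eq_sym.
    - exact: W.
  rewrite eqn_mod_dvd; last by rewrite leq_mul2r (ltnW ltl) orbT.
  rewrite -mulnBl Gauss_dvdr //.
  have lp : (0 < l - l' < pG G)%N by rewrite subn_gt0 ltl (leq_ltn_trans (leq_subr _ _)).
  rewrite /coprime eqn_leq gcdn_gt0 N0 andbT leqNgt.
  apply/negP => /pdiv_min_dvd/(_ (dvdn_gcdl _ _)); rewrite -/(pG G) => le_p.
  have := dvdn_leq (proj1 (andP lp)) (dvdn_gcdr N (l - l')).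
  by case/andP: lp => _ lp /(leq_trans le_p); rewrite leqNgt lp.
Qed.

(** [span_wait] turns the index into an upper bound for the l1-norm of the coefficients rather than
    its exact value. *)
Inductive span (S : {set G}) : nat -> G -> Prop :=
| span0 : span S 0 0
| span_wait m x : span S m x -> span S m.+1 x
| span_addr m x s : span S m x -> s \in S -> span S m.+1 (x + s)
| span_subr m x s : span S m x -> s \in S -> span S m.+1 (x - s).

Lemma span_leq S m n x : (m <= n)%N -> span S m x -> span S n x.
Proof.
by move/subnK <-; move: (n - m)%N => k xS; elim: k => // k; apply: span_wait.
Qed.

Lemma spanD S m n x y : span S m x -> span S n y -> span S (m + n) (x + y).
Proof.
move=> xS; elim => {n y} [|n y _ IH|n y s _ IH sS|n y s _ IH sS].
- by rewrite addn0 addr0.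
- by rewrite addnS; apply: span_wait.
- by rewrite addnS addrA; apply: span_addr.
- by rewrite addnS addrA; apply: span_subr.
Qed.

Lemma spanN S m x : span S m x -> span S m (- x).
Proof.
elim => {m x} [|m x _ IH|m x s _ IH sS|m x s _ IH sS].
- by rewrite oppr0; apply: span0.
- exact: span_wait.
- by rewrite opprD; apply: span_subr.
- by rewrite opprB addrC; apply: span_addr.
Qed.

Lemma span_gen (S : {set G}) s : s \in S -> span S 1 s.
Proof. by move=> sS; rewrite -[s]add0r; apply: span_addr => //; apply: span0. Qed.

Lemma span_sub (S S' : {set G}) m x : S \subset S' -> span S m x -> span S' m x.
Proof.
move=> /subsetP sub; elim => {m x} [|m x _ IH|m x s _ IH sS|m x s _ IH sS].
- exact: span0.
- exact: span_wait.
- by apply: span_addr => //; apply: sub.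
- by apply: span_subr => //; apply: sub.
Qed.

Lemma additive_mod0 N f : additive_mod N f -> (N%:Z %| f 0%R)%Z.
Proof.
move=> /(_ 0 0); rewrite addr0 => H; suff : (N%:Z %| - f 0%R)%Z by rewrite rpredN.
by rewrite (_ : - f 0 = f 0 - (f 0 + f 0)) //; ring.
Qed.

Lemma additive_modB N f x y : additive_mod N f -> (N%:Z %| f (x - y) - (f x - f y))%Z.
Proof.
move=> /(_ (x - y) y); rewrite subrK => H; suff : (N%:Z %| - (f (x - y)%R - (f x - f y)))%Z by rewrite rpredN.
by rewrite (_ : - _ = f x - (f (x - y) + f y)) //; ring.
Qed.

(** The values of [f] add up only modulo [N], so the sum of the small values at the generators is
    kept as a representative [z] of [f x]. *)
Lemma span_small (S : {set G}) (N Q : nat) f m x :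
  additive_mod N f -> (forall s, s \in S -> `|f s| * Q%:Z < N%:Z) -> span S m x ->
  exists2 z : int, (N%:Z %| z - f x)%Z & `|z| * Q%:Z <= m%:Z * N%:Z.
Proof.
move=> fD fS; elim => {m x} [|m x _ [z zx zle]|m x s _ [z zx zle] sS|m x s _ [z zx zle] sS].
- exists (0 : int); last by rewrite normr0 !mul0r.
  by rewrite sub0r rpredN additive_mod0.
- by exists z => //; nia.
- exists (z + f s); last by have := fS _ sS; nia.
  rewrite (_ : _ - _ = (z - f x) - (f (x + s) - (f x + f s))); last by ring.
  by rewrite rpredB.
- exists (z - f s); last by have := fS _ sS; nia.
  rewrite (_ : _ - _ = (z - f x) - (f (x - s) - (f x - f s))); last by ring.
  by rewrite rpredB // additive_modB.
Qed.

(* Induction on faces: a maximising face of [B] under a separating functional is a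
   proper subset, and a vanishing sum of differences never leaves that face. *)
Lemma extremal_point (S B : {set G}) (L Q r : nat) :
  (Q ^ #|S| < pG G)%N -> (2 * r * L < Q)%N ->
  B != set0 -> (forall b, b \in B -> span S L b) ->
  exists2 x, x \in B & forall l : seq G, {subset l <= B :\ x} ->
    (0 < size l <= r)%N -> \sum_(y <- l) (x - y) != 0.
Proof.
move=> QS rLQ; have Q0 : (0 < Q)%N by apply: leq_ltn_trans rLQ.
have [k] := ubnP #|B|; elim: k B => // k IH B Bk B0 BS.
have [/cards1P [x ->] | cB1] := boolP (#|B| == 1)%N.
  exists x; rewrite ?inE // => -[|y l] // /(_ y); rewrite !inE eqxx => /(_ isT).
  by case: eqP.
have : (1 < #|B|)%N by rewrite ltn_neqAle eq_sym cB1 card_gt0.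
move=> /card_gt1P [a [a' [aB a'B aa']]].
have g0 : a - a' != 0 by rewrite subr_eq0.
have [f [fD fS fg]] := small_separating_hom Q0 QS g0.
set N := #|G| in fD fS fg.
have lift b : exists z : int, b \in B ->
    (N%:Z %| z - f b)%Z /\ `|z| * Q%:Z <= L%:Z * N%:Z.
  have [bB|_] := boolP (b \in B); last by exists (0 : int).
  by have [z ? ?] := span_small fD fS (BS _ bB); exists z.
have [z zP] := fin_all_exists lift.
have zd b (bB : b \in B) := (zP b bB).1.
have [x0 x0B x0max] : exists2 x0, x0 \in B & forall b, b \in B -> z b <= z x0.
  by have [x0 ? ?] := arg_maxP (P := mem B) z aB; exists x0.
pose B1 := [set b in B | z b == z x0].
have zaa' : z a != z a'.
  apply: contra fg => /eqP e.
  rewrite (_ : f (a - a') = (f (a - a') - (f a - f a')) - (z a - f a) + (z a' - f a')); last first.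
    by rewrite e; ring.
  by apply: rpredD (zd _ a'B); apply: rpredB (zd _ aB); apply: additive_modB.
have [|||x] := IH B1.
- rewrite -ltnS; apply: leq_trans Bk; rewrite ltnS proper_card // properE.
  rewrite /B1 setIdE subsetIl /=; apply: contra zaa' => /subsetP sub.
  have := sub _ aB; have := sub _ a'B; rewrite !inE => /andP[_ /eqP ->].
  by case/andP => _ /eqP ->.
- by apply/set0Pn; exists x0; rewrite inE x0B eqxx.
- by move=> b; rewrite inE => /andP[bB _]; apply: BS.
rewrite inE => /andP[xB /eqP zx] xP; exists x => // l lB ls.
apply/negP => /eqP suml0; have lB' y : y \in l -> y \in B /\ y != x.
  by move=> /lB; rewrite !inE => /andP[].
have modl : (N%:Z %| \sum_(y <- l) (z x - z y) - f (\sum_(y <- l) (x - y)))%Z.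
  elim: {suml0 ls lB} l lB' => [|y l IHl] lB'.
    by rewrite !big_nil sub0r rpredN additive_mod0.
  rewrite !big_cons; set s := \sum_(y <- l) _; set t := \sum_(y <- l) _.
  have yB : y \in B by case: (lB' y); rewrite ?inE ?eqxx.
  rewrite (_ : _ - _ = (z x - f x) - (z y - f y) - (f (x - y) - (f x - f y)) + (s - f t) -
    (f (x - y + t) - (f (x - y) + f t))); last by ring.
  apply: rpredB (fD _ _); apply: rpredD; last first.
    by apply: IHl => w wl; apply: lB'; rewrite inE wl orbT.
  by apply: rpredB (additive_modB _ _ fD); apply: rpredB (zd _ yB); apply: zd.
have dN : (N%:Z %| \sum_(y <- l) (z x - z y))%Z.
  by move: modl; rewrite suml0 => /(rpredD)/(_ (additive_mod0 fD)); rewrite subrK.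
have ge0 y : y \in l -> 0 <= z x - z y.
  by move=> /lB' [yB _]; rewrite zx subr_ge0 x0max.
have bound : (\sum_(y <- l) (z x - z y)) * Q%:Z <= (size l)%:Z * (2 * L)%N%:Z * N%:Z.
  elim: {suml0 ls lB dN modl ge0} l lB' => [|y l IHl] lB'.
    by rewrite big_nil !mul0r.
  rewrite big_cons mulrDl /=.
  have yB : y \in B by case: (lB' y); rewrite ?inE ?eqxx.
  have /IHl IH' : forall w, w \in l -> w \in B /\ w != x.
    by move=> w wl; apply: lB'; rewrite inE wl orbT.
  have hx : z x * Q%:Z <= L%:Z * N%:Z.
    by apply: le_trans (zP _ xB).2; rewrite ler_wpM2r ?ler_norm.
  have hy : - z y * Q%:Z <= L%:Z * N%:Z.
    by apply: le_trans (zP _ yB).2; rewrite ler_wpM2r // -normrN ler_norm.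
  rewrite (_ : _.+1%:Z * _ * _ = (size l)%:Z * (2 * L)%N%:Z * N%:Z + (L%:Z * N%:Z + L%:Z * N%:Z)).
    by rewrite mulrBl -mulNr addrC; apply: lerD IH' (lerD hx hy).
  by rewrite -addn1 PoszD PoszM; ring.
(* The sum is a nonnegative multiple of [N], and [2 * r * L < Q] makes it less than [N]. *)
have sum0 : \sum_(y <- l) (z x - z y) = 0.
  have s0 : 0 <= \sum_(y <- l) (z x - z y) by rewrite big_seq; apply: sumr_ge0.
  have /dvdzP [c sE] := dN; rewrite {}sE in s0 bound *.
  have N0 : (0 < N)%N by apply/card_gt0P; exists a.
  have cQ : c * Q%:Z <= (size l)%:Z * (2 * L)%N%:Z.
    rewrite -(ler_pM2r (_ : 0 < N%:Z)); last by rewrite ltz_nat.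
    by apply: le_trans bound; rewrite mulrAC.
  have : ((size l * (2 * L))%N < Q)%N.
    apply: leq_ltn_trans rLQ; case/andP: ls => _ ls.
    by rewrite mulnCA -mulnA leq_mul2l leq_mul2r ls orbT.
  rewrite -ltz_nat PoszM => /(le_lt_trans cQ) cltQ.
  have c1 : c < 1 by rewrite -(ltr_pM2r (_ : 0 < Q%:Z)) ?ltz_nat // mul1r.
  have c0 : 0 <= c by rewrite -(ler_pM2r (_ : 0 < N%:Z)) ?ltz_nat // mul0r.
  by rewrite (_ : c = 0) ?mul0r //; lia.
have lB1 : {subset l <= B1 :\ x}.
  move: sum0; rewrite big_seq => /eqP; rewrite psumr_eq0; last by move=> y /ge0.
  move=> /allP all0 y yl; have [yB yx] := lB' _ yl.
  by move: (all0 _ yl); rewrite yl !inE yx yB /= subr_eq0 -zx eq_sym.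
by have := xP _ lB1 ls; rewrite suml0 eqxx.
Qed.
End Extremal.

(** * Random colourings and monochromatic triples *)

Section Colouring.
Variables (T : finType) (q : nat).

Definition verts (e : T * T * T) := [:: e.1.1; e.1.2; e.2].

Definition matching (l : seq (T * T * T)) :=
  pairwise (fun e e' => ~~ has (mem (verts e)) (verts e')) l.

(** Greedy choice: either the vertices of the current matching meet all triples, or a triple that
    they miss extends the matching. *)
Lemma matching_or_cover (E : {set T * T * T}) (M : nat) :
  (exists l, [/\ size l = M, {subset l <= E} & matching l]) \/
  (exists2 W : {set T}, #|W| <= 3 * M & forall e, e \in E -> has (mem W) (verts e)).
Proof.
elim: M => [|M [[l [lM lE lmatch]]|[W WM WE]]].
- by left; exists [::].
- pose W := [set v in flatten (map verts l)].
  have WM : #|W| <= 3 * M.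
    rewrite cardsE (leq_trans (card_size _)) // size_flatten -lM /shape -map_comp.
    by elim: (l) => //= e l' IH; lia.
  have [WE|] := boolP [forall e in E, has (mem W) (verts e)].
    by right; exists W; [lia | exact/forall_inP].
  rewrite negb_forall_in => /exists_inP [e eE eW]; left; exists (e :: l); split.
  + by rewrite /= lM.
  + by move=> e'; rewrite inE => /predU1P [-> //|/lE].
  + rewrite /matching pairwise_cons -/(matching l) lmatch andbT; apply/allP => e' e'l.
    apply: contra eW => /hasP [v ve' ve]; apply/hasP; exists v => //=.
    by rewrite inE; apply/flattenP; exists (verts e') => //; apply: map_f.
- by right; exists W => //; lia.
Qed.

Definition monochromatic (f : {ffun T -> 'I_q}) i e := all (fun v => f v == i) (verts e).

Definition avoiding i l := [set f | all (fun e => ~~ monochromatic f i e) l].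

(** Each triple is entirely of colour [i] with probability at least [1 / q ^ 3], and disjoint
    triples are independent. This is the product bound with denominators cleared. *)
Lemma card_avoiding i l : matching l ->
  #|avoiding i l| * (q ^ 3) ^ size l <= q ^ #|T| * (q ^ 3 - 1) ^ size l.
Proof.
elim: l => [_|e l IH].
  by rewrite !expn0 !muln1 (leq_trans (max_card _)) // card_ffun card_ord.
rewrite /matching pairwise_cons -/(matching l) => /andP [/allP el /IH {}IH].
pose H := [set f in avoiding i l | monochromatic f i e].
have splitE : #|avoiding i (e :: l)| + #|H| = #|avoiding i l|.
  rewrite -(cardsID [set f | monochromatic f i e] (avoiding i l)) addnC.
  by congr (_ + _); apply: eq_card => f; rewrite !inE //= andbC.
(* Recolour [e] with [i]: the triples of [l] are disjoint from [e] and keep their colours, and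
   recording the three old colours makes the map injective. *)
have le_H : #|avoiding i l| <= q ^ 3 * #|H|.
  pose over (f : {ffun T -> 'I_q}) := [ffun v => if v \in verts e then i else f v].
  pose F f := (over f, (f e.1.1, f e.1.2, f e.2)).
  have Finj : injective F.
    move=> f g [fg h1 h2 h3]; apply/ffunP => v; have /ffunP/(_ v) := fg.
    by rewrite !ffunE; case: ifP => //; rewrite !inE => /or3P [] /eqP ->.
  rewrite -(card_imset _ Finj).
  suff /subset_leq_card : F @: avoiding i l \subset setX H [set: 'I_q * 'I_q * 'I_q].
    by move=> /leq_trans -> //; rewrite cardsX cardsT !card_prod card_ord; lia.
  apply/subsetP => _ /imsetP [f fl ->]; rewrite !inE andbT; apply/andP; split.
    apply/allP => e' e'l; rewrite inE in fl; have := allP fl _ e'l; apply: contra => /allP mono.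
    apply/allP => v ve'; have := mono _ ve'; rewrite ffunE.
    by have := el _ e'l; rewrite -all_predC => /allP/(_ _ ve') /= /negbTE ->.
  by apply/allP => v ve; rewrite ffunE ve.
have [q0|q0] := posnP (q ^ 3).
  by rewrite !(expnS _ (size l)) q0 mul0n muln0.
rewrite !(expnS _ (size l)); move: IH; set a := #|avoiding i (e :: l)|; set x := _ ^ size l; set y := (q ^ 3 - 1) ^ _.
move: (q ^ #|T|) => t IH.
have : q ^ 3 * a <= (q ^ 3 - 1) * #|avoiding i l| by nia.
nia.
Qed.

(** A union bound over all colours and all of [J0] gives a colouring in which every class works, so
    the sparsest class on [A] can be taken. *)
Lemma monochromatic_class (J : finType) (J0 : {set J}) (E : J -> {set T * T * T})
    (M : nat) (A : {set T}) : 0 < q ->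
  (forall j, j \in J0 -> exists l, [/\ size l = M, {subset l <= E j} & matching l]) ->
  (forall j e, j \in J0 -> e \in E j -> all (mem A) (verts e)) ->
  q * #|J0| * (q ^ 3 - 1) ^ M < (q ^ 3) ^ M ->
  exists2 S : {set T}, q * #|S| <= #|A| &
    forall j, j \in J0 -> exists2 e, e \in E j & all (mem S) (verts e).
Proof.
move=> q0 El EA qM.
have /fin_all_exists [L LP] j : exists l, j \in J0 -> [/\ size l = M, {subset l <= E j} & matching l].
  have [/El [l lP]|_] := boolP (j \in J0); first by exists l.
  by exists [::].
pose bad := \bigcup_(ij : 'I_q * J | ij.2 \in J0) avoiding ij.1 (L ij.2).
have [f fbad] : exists f, f \notin bad.
  apply/existsP; rewrite -negb_forall; apply/negP => /forallP allbad.
  have : q ^ #|T| <= #|bad|.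
    rewrite -{1}(card_ord q) -card_ffun; apply/subset_leq_card/subsetP => f _; exact: allbad.
  have badle : #|bad| * (q ^ 3) ^ M <= q * #|J0| * (q ^ #|T| * (q ^ 3 - 1) ^ M).
    apply: (@leq_trans (\sum_(ij : 'I_q * J | ij.2 \in J0) #|avoiding ij.1 (L ij.2)| * (q ^ 3) ^ M)).
      rewrite -big_distrl /= leq_mul2r; apply/orP; right.
      rewrite /bad; elim/big_rec2: _ => [|ij n B _ IH]; first by rewrite cards0.
      by rewrite (leq_trans (leq_card_setU _ _)) // leq_add2l.
    rewrite (_ : q * #|J0| = #|[pred ij : 'I_q * J | ij.2 \in J0]|); last first.
      rewrite -{1}(card_ord q) -cardsT -cardsX; apply: eq_card => ij; rewrite !inE //.
    rewrite -sum_nat_const; apply: leq_sum => ij /LP [sz _ mt].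
    by have := card_avoiding ij.1 mt; rewrite sz.
  move=> bad_ge.
  have qT : 0 < q ^ #|T| by rewrite expn_gt0 q0.
  have := leq_trans (leq_mul bad_ge (leqnn _)) badle.
  by rewrite mulnCA leq_pmul2l // leqNgt qM.
pose C i := A :&: [set v | f v == i].
have sumC : \sum_i #|C i| = #|A|.
  rewrite -sum1_card (partition_big f xpredT) //=; apply: eq_bigr => i _.
  by rewrite -sum1_card; apply: eq_bigl => v; rewrite !inE.
have [i0 _ i0min] := arg_minnP (fun i => #|C i|) (isT : xpredT (Ordinal q0)).
exists (C i0).
  by rewrite -sumC -[X in X * _](card_ord q) -sum_nat_const leq_sum // => i _; apply: i0min.
move=> j jJ; have [szL LE _] := LP j jJ.
have : f \notin avoiding i0 (L j).
  apply: contra fbad => fav; apply/bigcupP; by exists (i0, j).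
rewrite inE -has_predC => /hasP [e eL /negPn mono]; exists e; first exact: LE.
apply/allP => v ve; rewrite !inE (allP mono) // andbT.
by apply: (allP (EA _ _ jJ (LE _ eL))).
Qed.
End Colouring.

(** * Sets without unique sums: the bound from a spanning set *)

Section NoUniqueSum.
Local Open Scope ring_scope.
Variables (G : finZmodType) (A : {set G}).

(** Otherwise [A] has an extremal point [x] for two differences. If [x + x = y + w] with [y] and [w]
    other than [x], then [(x - y) + (x - w)] vanishes; so [x + x] would be a unique sum. *)
Lemma no_unique_sum_bound (S : {set G}) (L : nat) :
  A != set0 -> ~ has_unique_sum A -> (forall a, a \in A -> span S L a) ->
  (pG G <= (4 * L + 1) ^ #|S|)%N.
Proof.
move=> A0 nU AS; rewrite leqNgt; apply/negP => QS.
have [|x xA xP] := extremal_point (r := 2) QS _ A0 AS; first by lia.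
apply: nU; exists x, x; do 2!split => //; move=> y w yA wA yw.
have [ey|nyx] := eqVneq y x; first by left; split=> //; apply: (addrI x); rewrite -yw ey.
have [ew|nwx] := eqVneq w x.
  by left; split=> //; apply: (addIr x); rewrite -yw ew.
have sub : {subset [:: y; w] <= A :\ x}.
  by move=> v; rewrite !inE => /orP [] /eqP ->; rewrite ?nyx ?nwx.
have := xP _ sub isT.
by rewrite !big_cons big_nil addr0 addrACA -opprD yw subrr eqxx.
Qed.

Lemma other_representation x y : ~ has_unique_sum A -> x \in A -> y \in A ->
  exists b c, [/\ b \in A, c \in A, b != x, c != x & x + y = b + c].
Proof.
move=> nU xA yA.
have [/existsP [b /existsP [c /and5P [bA cA bx cx /eqP e]]]|no] :=
  boolP [exists b, [exists c, [&& b \in A, c \in A, b != x, c != x & x + y == b + c]]].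
  by exists b, c.
case: nU; exists x, y; do 2!split => //; move=> b c bA cA bc.
have [eb|bx] := eqVneq b x; first by left; split=> //; apply: (addrI x); rewrite -bc eb.
have [ec|cx] := eqVneq c x.
  by right; split=> //; apply: (addIr x); rewrite -ec bc ec addrC.
by case/negP: no; apply/existsP; exists b; apply/existsP; exists c; rewrite bA cA bx cx bc /=.
Qed.

(** * Rich pairs and the graph that they form on [A] *)

Variable M : nat.

Definition sum_triples x := [set e : G * G * G |
  [&& all (mem A) (verts e), e.1.2 != x, e.2 != x & x + e.1.1 == e.1.2 + e.2]].

(** A pair [(a, a + d)] is written as a triple with its last vertex repeated, so that the results on
    triples apply to it. *)
Definition shift_triples d := [set e : G * G * G |
  [&& all (mem A) (verts e), e.1.2 == e.1.1 + d & e.2 == e.1.2]].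

(** The diagonal, where the difference would be 0, carries the relations [x + a = b + c] instead.
    One notion of richness and one colouring thus serve both kinds. *)
Definition triples x t := if x == t then sum_triples x else shift_triples (x - t).

(* By [matching_or_cover], rich pairs are those whose triples contain [M] disjoint ones. *)
Definition rich x t := [forall W : {set G}, (#|W| <= 3 * M)%N ==>
  [exists e in triples x t, ~~ has (mem W) (verts e)]].

Lemma richP x t : rich x t ->
  exists l, [/\ size l = M, {subset l <= triples x t} & matching l].
Proof.
move=> /forallP r; have [//|[W WM WE]] := matching_or_cover (triples x t) M.
by have := implyP (r W) WM => /exists_inP [e /WE ->].
Qed.

Lemma poorP x t : ~~ rich x t -> exists2 W : {set G}, (#|W| <= 3 * M)%N &
  forall e, e \in triples x t -> has (mem W) (verts e).
Proof.
rewrite negb_forall => /existsP [W]; rewrite negb_imply => /andP [WM].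
by rewrite negb_exists_in => /forall_inP WE; exists W => // e /WE; rewrite negbK.
Qed.

Lemma rich_shift x t a : x != t -> rich (a + (x - t)) a = rich x t.
Proof.
move=> xt; rewrite /rich /triples (negbTE xt) ifN ?[a + _]addrC ?addrK //.
by rewrite -subr_eq0 addrK subr_eq0.
Qed.

Definition edge x y := [&& x \in A, y \in A, x != y & rich x y || rich y x].

Definition nbrs X := X :|: [set y | [exists x in X, edge x y]].

Definition ball a j := iter j nbrs [set a].

Lemma ball_self a j : a \in ball a j.
Proof. by elim: j => [|j IH]; rewrite /= inE ?eqxx ?IH. Qed.

Lemma ball_subset a j : a \in A -> ball a j \subset A.
Proof.
move=> aA; elim: j => [|j IH] /=; first by rewrite sub1set.
rewrite subUset IH; apply/subsetP => y; rewrite inE => /exists_inP [x _].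
by case/and4P.
Qed.

(** Each step adds a vertex until the ball is closed under neighbours. *)
Lemma ball_growth a j : nbrs (ball a j) = ball a j \/ (j < #|ball a j|)%N.
Proof.
elim: j => [|j [IH|IH]]; first by right; rewrite cards1.
  by left; rewrite /= !IH.
have [e|ne] := eqVneq (nbrs (ball a j)) (ball a j); first by left; rewrite /= !e.
right; apply: (leq_ltn_trans IH); apply: proper_card.
by rewrite properEneq eq_sym ne subsetUl.
Qed.

Lemma small_ball_closed a j x y : (#|ball a j| <= j)%N ->
  x \in ball a j -> edge x y -> y \in ball a j.
Proof.
move=> small xB xy; have [<-|] := ball_growth a j; last by rewrite ltnNge small.
by rewrite !inE; apply/orP; right; apply/exists_inP; exists x.
Qed.

(** With [W] covering the shift triples, each such [a] lies in [W] or in its translate by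
    [-(x - t)]. *)
Lemma shift_set_bound x t : x != t -> ~~ rich x t ->
  (#|[set a in A | (a + (x - t))%R \in A]| <= 6 * M)%N.
Proof.
move=> xt /poorP [W WM WE].
apply: (@leq_trans #|W :|: [set (w - (x - t))%R | w in W]|).
  apply/subset_leq_card/subsetP => a; rewrite inE => /andP [aA axA].
  have /WE : (a, a + (x - t), a + (x - t)) \in triples x t.
    by rewrite /triples (negbTE xt) !inE /= aA axA !eqxx.
  rewrite /verts /= orbF orbb inE => /orP [aW|axW]; first by rewrite aW.
  by apply/orP; right; apply/imsetP; exists (a + (x - t)); rewrite ?addrK.
apply: (leq_trans (leq_card_setU _ _)); apply: (@leq_trans (#|W| + #|W|)).
  by rewrite leq_add2l leq_imset_card.
by lia.
Qed.

(** A single small component [C0] without rich [y y] fixes [x] and [X], and this [X] then meets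
    every small ball. It consists of at most [3 * M] covering elements and, for each of them, at
    most [6 * M] elements of a poor shift set. *)
Lemma small_balls_hit K : ~ has_unique_sum A -> ((2 * K + 1) ^ K < pG G)%N ->
  exists2 X : {set G}, (#|X| <= 3 * M + 18 * M ^ 2)%N &
    forall a, a \in A -> (#|ball a K| <= K)%N ->
      exists2 y, y \in ball a K & rich y y || (y \in X).
Proof.
move=> nU Kp.
have [/existsP [a0 /and3P [a0A sm0 /forall_inP poor0]]|no] :=
  boolP [exists a, [&& a \in A, (#|ball a K| <= K)%N & [forall y in ball a K, ~~ rich y y]]]; last first.
  exists set0; first by rewrite cards0.
  move=> a aA sm; move: no; rewrite negb_exists => /forallP /(_ a).
  by rewrite aA sm /= negb_forall_in => /exists_inP [y yB /negPn ry]; exists y; rewrite ?ry.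
set C0 := ball a0 K in sm0 poor0.
have QC : ((2 * K + 1) ^ #|C0| < pG G)%N.
  by apply: leq_ltn_trans Kp; rewrite leq_pexp2l // addn1.
(* [C0] spans itself with norm 1, so [Q = 2 * K + 1] allows for sums of up to [K] differences. *)
have [||x xC xP] := extremal_point (r := K) (B := C0) QC _ _ (@span_gen _ C0).
- by rewrite muln1 addn1.
- by apply/set0Pn; exists a0; apply: ball_self.
have C0A : C0 \subset A := ball_subset K a0A.
have xA := subsetP C0A _ xC.
have [W WM WE] := poorP (poor0 x xC).
pose D t := [set a in A | a + (x - t) \in A].
pose X := W :|: \bigcup_(t in W | (x != t) && ~~ rich x t) D t.
(* In [x + a = b + c], one of [b] and [c] lies in [W]; call it [t]. As [a] is not in [D t], the
   difference [x - t] is rich. Hence [t] is a neighbour of [x], and [a + (x - t)] is one of [a]. *)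
have step a : a \in A -> a \notin X -> exists t, [/\ t \in C0, t != x & edge a (a + (x - t))].
  move=> aA; rewrite inE negb_or => /andP [aW aD].
  have [b [c [bA cA bx cx bc]]] := other_representation nU xA aA.
  have main t u : t \in A -> u \in A -> t != x -> x + a = t + u -> t \in W ->
      exists t, [/\ t \in C0, t != x & edge a (a + (x - t))].
    move=> tA uA tx tu tW; have atA : a + (x - t) \in A.
      by rewrite addrA [a + x]addrC tu addrAC subrr add0r.
    have rxt : rich x t.
      apply: contraNT aD => nr; apply/bigcupP; exists t.
        by rewrite tW eq_sym tx.
      by rewrite inE aA.
    exists t; split => //.
      by apply: (small_ball_closed sm0 xC); rewrite /edge xA tA eq_sym tx rxt.
    have xt : x != t by rewrite eq_sym.
    have aat : a != a + (x - t).
      by apply: contraNneq xt => e; rewrite -subr_eq0 -(addKr a (x - t)) -e addNr.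
    by rewrite /edge aA atA aat rich_shift // rxt orbT.
  have /WE : (a, b, c) \in triples x x.
    by rewrite /triples eqxx !inE /= aA bA cA bx cx bc eqxx.
  rewrite /verts /= (negbTE aW) orbF /= => /orP [bW|cW].
    by apply: (main b c).
  by apply: (main c b) => //; rewrite bc addrC.
exists X.
  have DM t : (x != t) && ~~ rich x t -> (#|D t| <= 6 * M)%N.
    by case/andP; apply: shift_set_bound.
  have : (#|\bigcup_(t in W | (x != t) && ~~ rich x t) D t| <= \sum_(t in W) 6 * M)%N.
    rewrite [X in (_ <= X)%N](bigID (fun t => (x != t) && ~~ rich x t)) /=.
    apply: leq_trans (leq_addr _ _).
    elim/big_rec2: _ => [|t n B /andP [_ tP] IH]; first by rewrite cards0.
    by rewrite (leq_trans (leq_card_setU _ _)) // leq_add // DM.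
  rewrite sum_nat_const => DW; rewrite (leq_trans (leq_card_setU _ _)) //.
  by nia.
move=> a aA sm; have [/exists_inP [y yB yX]|noX] := boolP [exists y in ball a K, y \in X].
  by exists y; rewrite ?yX ?orbT.
exfalso; set C := ball a K in sm noX.
have CA : C \subset A := ball_subset K aA.
have stepC b : exists t, b \in C -> [/\ t \in C0, t != x & edge b (b + (x - t))].
  have [bC|] := boolP (b \in C); last by exists 0.
  have [||t tP] := step b; [exact: (subsetP CA) | | by exists t].
  by apply: contra noX => bX; apply/exists_inP; exists b.
have [t tP] := fin_all_exists stepC.
pose z i := iter i (fun b => b + (x - t b)) a.
have zC i : z i \in C.
  elim: i => [|i IH] /=; first exact: ball_self.
  by have [_ _] := tP _ IH; apply: small_ball_closed.
(* The walk takes [K + 1] positions among at most [K] points. Around the resulting loop the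
   differences [x - t] telescope to 0, against the choice of [x]. *)
have [i [j [ij jK zij]]] : exists i j, [/\ (i < j)%N, (j <= K)%N & z i = z j].
  have /injectivePn [i [j ij zij]] : ~~ injectiveb (fun i : 'I_K.+1 => z i).
    apply/injectiveP => zinj.
    have sub : [set z i | i : 'I_K.+1] \subset C by apply/subsetP => _ /imsetP [i _ ->].
    by have := leq_trans (subset_leq_card sub) sm; rewrite card_imset // card_ord ltnn.
  case: (ltngtP i j) => [lt|lt|/val_inj e]; last by rewrite e eqxx in ij.
    by exists i, j; split => //; rewrite -ltnS.
  by exists j, i; split => //; rewrite -ltnS.
have sub : {subset [seq t (z m) | m <- index_iota i j] <= C0 :\ x}.
  by move=> y /mapP [m _ ->]; have [tC tx _] := tP _ (zC m); rewrite !inE tx tC.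
have := xP _ sub; rewrite size_map size_iota big_map subn_gt0 ij (leq_trans (leq_subr _ _)) //.
rewrite (eq_bigr (fun m => z m.+1 - z m)); last by move=> m _; rewrite /= [_ + (x - _)]addrC addrK.
by rewrite telescope_sumr ?(ltnW ij) // zij subrr eqxx => /(_ isT).
Qed.

(** A triple inside the sparse class gives [x = b + c - a] on the diagonal and [x - t = b - a] off
    it. *)
Lemma rich_spans K : (0 < K)%N -> (K * #|A| ^ 2 * (K ^ 3 - 1) ^ M < (K ^ 3) ^ M)%N ->
  exists2 S : {set G}, (K * #|S| <= #|A|)%N & forall x t, x \in A -> t \in A ->
    rich x t -> if x == t then span S 3 x else span S 2 (x - t).
Proof.
move=> K0 KM; pose J0 := [set xt in setX A A | rich xt.1 xt.2].
have [|||S SA SP] := @monochromatic_class _ K _ J0 (fun xt => triples xt.1 xt.2) M A K0.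
- by move=> [x t]; rewrite !inE => /andP [_ /richP].
- move=> [x t] e _; rewrite /triples; case: eqP => _; rewrite inE => /andP []//.
- apply: leq_ltn_trans KM; rewrite leq_mul2r leq_mul2l; apply/orP; right; apply/orP; right.
  by rewrite expnS expn1 -cardsX subset_leq_card // /J0 setIdE subsetIl.
exists S => // x t xA tA rxt.
have [|e] := SP (x, t); first by rewrite !inE xA tA.
rewrite /triples /=; case: eqVneq => _; rewrite inE /verts /=.
  move=> /and4P [_ _ _ /eqP e1] /and4P [s1 s2 s3 _].
  have -> : x = e.1.2 + e.2 - e.1.1 by rewrite -e1 addrK.
  by apply: span_subr s1; apply: span_addr s3; apply: span_gen.
move=> /and3P [_ /eqP e1 _] /and4P [s1 s2 _ _].
have -> : x - t = e.1.2 - e.1.1 by rewrite e1 [_ + (x - t)]addrC addrK.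
by apply: span_subr s1; apply: span_gen.
Qed.

Lemma span_ball S a j y : (forall x t, x \in A -> t \in A -> x != t -> rich x t -> span S 2 (x - t)) ->
  y \in ball a j -> span S (2 * j) (y - a).
Proof.
move=> rS; elim: j y => [|j IH] y; rewrite /= !inE.
  by move/eqP ->; rewrite subrr; apply: span0.
case/orP => [/IH|/exists_inP [x xB /and4P [xA yA xy r]]]; first by apply: span_leq; lia.
have yx : span S 2 (y - x).
  case/orP: r => [/rS|/rS]; last by apply=> //; rewrite eq_sym.
  by move=> /(_ xA yA xy)/spanN; rewrite opprB.
by rewrite -(subrKA x) mulnS; apply: spanD yx (IH _ xB).
Qed.

(** * Covering by few centres, and the short spanning set *)

(** Take [Z] maximal with the sets [F z] pairwise disjoint: disjointness bounds its size, and by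
    maximality every [F x] meets some [F z]. *)
Lemma separated_centers (T : finType) (B X : {set T}) (F : T -> {set T}) (k : nat) : (0 < k)%N ->
  (forall x, x \in X -> F x \subset B /\ (k <= #|F x|)%N) ->
  exists2 Z : {set T}, (k * #|Z| <= #|B|)%N &
    forall x, x \in X -> exists z y, [/\ z \in Z, z \in X, y \in F x & y \in F z].
Proof.
move=> k0 FX.
pose P (Z : {set T}) := (Z \subset X) && [forall z in Z, forall w in Z, (z != w) ==> [disjoint F z & F w]].
have [|Z /maxsetP [/andP [ZX /forall_inP Zdis] Zmax]] := @ex_maxset _ P.
  by exists set0; rewrite /P sub0set; apply/forall_inP => z; rewrite inE.
have Zd z w y : z \in Z -> w \in Z -> y \in F z -> y \in F w -> z = w.
  move=> zZ wZ yz yw; apply/eqP; apply: contraTT yw => zw.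
  by have := implyP (forall_inP (Zdis z zZ) w wZ) zw => /disjointFr ->.
exists Z.
  rewrite mulnC -sum_nat_const.
  apply: (@leq_trans (\sum_(z in Z) \sum_(y in B) (y \in F z))).
    apply: leq_sum => z zZ; have [FB kF] := FX z (subsetP ZX _ zZ).
    apply: leq_trans kF _; rewrite -sum1_card big_mkcond [X in (_ <= X)%N]big_mkcond leq_sum // => y _.
    by case: ifP => // yF; rewrite (subsetP FB _ yF).
  rewrite exchange_big /= -sum1_card leq_sum // => y _.
  have [/existsP [z /andP [zZ yz]]|no] := boolP [exists z, (z \in Z) && (y \in F z)].
    rewrite (bigD1 z) //= big1 ?addn0 ?leq_b1 // => w /andP [wZ wz].
    by apply/eqP; rewrite eqb0; apply: contra wz => yw; rewrite (Zd z w y).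
  rewrite big1 // => z zZ; apply/eqP; rewrite eqb0; apply: contra no => yz.
  by apply/existsP; exists z; rewrite zZ.
move=> x xX; have [/existsP [z /existsP [y /and4P [zZ zX yx yz]]]|no] :=
  boolP [exists z, [exists y, [&& z \in Z, z \in X, y \in F x & y \in F z]]].
  by exists z, y.
have [FB kF] := FX x xX.
have xdis z y : z \in Z -> y \in F x -> y \in F z -> False.
  move=> zZ yx yz; case/existsP: no; exists z; apply/existsP; exists y.
  by rewrite zZ yx yz (subsetP ZX _ zZ).
have xZ : x \notin Z.
  apply/negP => xZ; have /card_gt0P [y yx] : (0 < #|F x|)%N by apply: leq_trans kF.
  exact: (xdis x y).
case/negP: xZ; rewrite -(Zmax (x |: Z)) ?subsetUr ?setU11 //.
rewrite /P subUset sub1set xX ZX /=; apply/forall_inP => z zZ; apply/forall_inP => w wZ.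
apply/implyP => zw; rewrite -setI_eq0; apply/eqP/setP => y; rewrite !inE.
apply/negbTE/negP => /andP [yz yw]; move: zZ wZ zw; rewrite !inE.
case/predU1P => [ez|zZ]; case/predU1P => [ew|wZ].
- by rewrite ez ew eqxx.
- by rewrite ez in yz; case: (xdis w y).
- by rewrite ew in yw; case: (xdis z y).
- by rewrite (Zd z w y) ?eqxx.
Qed.

Lemma short_spanning_set K : (0 < K)%N -> ~ has_unique_sum A ->
  ((2 * K + 1) ^ K < pG G)%N -> (K * #|A| ^ 2 * (K ^ 3 - 1) ^ M < (K ^ 3) ^ M)%N ->
  exists2 S : {set G}, (K * #|S| <= 2 * #|A| + K * (3 * M + 18 * M ^ 2))%N &
    forall a, a \in A -> span S (4 * K + 3) a.
Proof.
move=> K0 nU Kp KM.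
have [S SA SP] := rich_spans K0 KM; have [X XM XP] := small_balls_hit nU Kp.
pose big := [set a in A | (K < #|ball a K|)%N].
have [|Z ZA ZP] := @separated_centers _ A big (ball^~ K) K K0.
  by move=> a; rewrite inE => /andP [aA /ltnW]; rewrite ball_subset.
(* The sparse class and the centres have at most [#|A| / K] elements each. A path of length [K]
   costs [2 * K]: two of them and a centre cost [4 * K + 1], while one path and a rich or
   exceptional element cost at most [2 * K + 3]. *)
pose S' := S :|: Z :|: X.
have SS' : S \subset S' by rewrite /S' -setUA subsetUl.
have near a y : y \in ball a K -> span S' (2 * K) (y - a).
  move=> yB; apply: span_sub SS' _; apply: span_ball yB => x t xA tA xt rxt.
  by have := SP x t xA tA rxt; rewrite (negbTE xt).
exists S'.
  have cS' : (#|S'| <= #|S| + #|Z| + #|X|)%N.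
    by apply: leq_trans (leq_card_setU _ _) _; rewrite leq_add2r leq_card_setU.
  apply: leq_trans (leq_mul (leqnn K) (leq_trans cS' (leq_add (leqnn _) XM))) _.
  by rewrite mulnDr leq_add2r mulnDr mul2n -addnn leq_add.
move=> a aA; have [bigB|sm] := ltnP K #|ball a K|.
  have [|z [y [zZ _ ya yz]]] := ZP a; first by rewrite inE aA.
  have -> : a = y - z + z - (y - a) by rewrite subrK opprB addrC subrK.
  apply: (@span_leq _ _ (2 * K + 1 + 2 * K)); first by lia.
  apply: spanD (spanN (near _ _ ya)); apply: spanD (near _ _ yz) _.
  by apply: span_gen; rewrite !inE zZ orbT.
have [y yB yX] := XP a aA sm.
have -> : a = y - (y - a) by rewrite opprB addrC subrK.
apply: (@span_leq _ _ (3 + 2 * K)); first by lia.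
apply: spanD (spanN (near _ _ yB)).
case/orP: yX => [ry|yX]; last by apply: (span_leq (m := 1)) => //; apply: span_gen; rewrite !inE yX orbT.
have yA := subsetP (ball_subset K aA) _ yB.
by apply: span_sub SS' _; have := SP y y yA yA ry; rewrite eqxx.
Qed.
End NoUniqueSum.

(** * Integer estimates and the choice of parameters *)

Section Numerics.

(** Bernoulli's inequality for [(1 - 1/m) ^ j] without denominators; truncated subtraction makes it
    trivial for [j >= m]. *)
Lemma bernoulli_lower m j : m ^ j * (m - j) <= m * (m - 1) ^ j.
Proof.
elim: j => [|j IH]; first by rewrite !expn0 subn0 mul1n muln1.
have [lt|ge] := ltnP j m; last by rewrite (eqP (_ : m - j.+1 == 0)) ?muln0 // subn_eq0 leqW.
rewrite expnSr (expnSr (m - 1)) mulnA.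
apply: (@leq_trans (m ^ j * (m - j) * (m - 1))); last by rewrite leq_mul2r IH orbT.
by rewrite -!mulnA leq_mul2l; apply/orP; right; nia.
Qed.

Lemma bernoulli_upper m j : m ^ j * (m + j) <= m * m.+1 ^ j.
Proof.
elim: j => [|j IH]; first by rewrite !expn0 addn0 mul1n muln1.
rewrite expnSr (expnSr m.+1) mulnA.
apply: (@leq_trans (m ^ j * (m + j) * m.+1)); last by rewrite leq_mul2r IH orbT.
by rewrite -!mulnA leq_mul2l; apply/orP; right; nia.
Qed.

(** With [m = q - 1], Bernoulli gives [(1 + 1/m) ^ (m + 1) >= 1 + (m + 1)/m >= 2]. *)
Lemma double_pred_expn q : 1 < q -> 2 * (q - 1) ^ q <= q ^ q.
Proof.
case: q => // m m0; rewrite subSS subn0.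
rewrite -(leq_pmul2l (_ : 0 < m)) //; apply: leq_trans (bernoulli_upper m m.+1).
by rewrite mulnA mulnC leq_mul2l; apply/orP; right; lia.
Qed.

Lemma expn9_leq_expn2 K : 128 <= K -> 171 * K ^ 9 <= 2 ^ K.-1.
Proof.
have base a : 171 * (2 ^ a) ^ 9 <= 2 ^ (a * 9 + 8).
  by rewrite expnD expnM mulnC leq_mul2l orbC.
move=> /subnK <-; elim: (K - 128) => [|k IH].
  apply: leq_trans (base 7) _; exact: (@leq_pexp2l 2 71 127 isT isT).
move: IH; rewrite addSn; set m := k + 128; have m128 : 128 <= m by rewrite leq_addl.
move=> IH; rewrite -pred_Sn; have -> : 2 ^ m = 2 ^ m.-1 + 2 ^ m.-1.
  by rewrite addnn -mul2n -expnS prednK // (leq_trans _ m128).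
(* Bernoulli gives [(m / (m + 1)) ^ 9 >= 1 - 9 / (m + 1)], which is at least 1/2 here. *)
have step : m.+1 ^ 9 <= 2 * m ^ 9.
  rewrite -(leq_pmul2l (ltn0Sn m)).
  have := bernoulli_lower m.+1 9; rewrite subn1 succnK => b.
  apply: (@leq_trans (2 * (m.+1 ^ 9 * (m.+1 - 9)))).
    by rewrite mulnCA [m.+1 * _]mulnC leq_mul2l; apply/orP; right; lia.
  by rewrite [leqRHS]mulnCA leq_mul2l b.
apply: leq_trans (leq_add IH IH).
by apply: leq_trans (leq_mul (leqnn 171) step) _; rewrite mulnCA mul2n addnn.
Qed.

Lemma pG_leq_expn (G : finZmodType) (A : {set G}) :
  A != set0 -> ~ has_unique_sum A ->
  let K := (trunc_log 2 #|A|).+1 in 128 <= K ->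
  exists s, K * s <= 3 * #|A| /\ pG G <= (16 * K + 13) ^ s.
Proof.
move=> A0 nU K K128.
have K0 : 0 < K by [].
have n0 : 0 < #|A| by rewrite card_gt0.
have nK : #|A| < 2 ^ K by rewrite trunc_log_ltn.
have Kn : 171 * K ^ 9 <= #|A|.
  by apply: leq_trans (expn9_leq_expn2 K128) _; rewrite trunc_logP.
clearbody K; have pow a b : a <= b -> K ^ a <= K ^ b by apply: leq_pexp2l.
(* If [pG G] is too small for the extremal argument in small components, [s = K] already gives the
   bound. *)
have [Kp|Kp] := leqP (pG G) ((2 * K + 1) ^ K).
  exists K; split.
    have := pow 2 9 isT; rewrite expnS expn1; lia.
  by apply: leq_trans Kp _; rewrite leq_exp2r //; lia.
(* [K ^ 3 * j] disjoint triples are all missed with probability at most [2 ^ -j],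
   and [j = 3 K] beats the [K n^2 < 2 ^ (3 K)] events. *)
pose M := K ^ 3 * (3 * K).
have KM : K * #|A| ^ 2 * (K ^ 3 - 1) ^ M < (K ^ 3) ^ M.
  have K3 : 1 < K ^ 3 by rewrite (leq_trans (_ : 1 < K ^ 1)) ?pow // expn1; lia.
  apply: (@leq_trans (2 ^ (3 * K) * (K ^ 3 - 1) ^ M)).
    rewrite ltn_pmul2r; last by rewrite expn_gt0 subn_gt0 K3.
    rewrite mulSn expnD (mulnC 2 K) expnM.
    by apply: ltn_mul; [apply: ltn_expl | rewrite ltn_exp2r].
  by rewrite /M !(expnM _ (K ^ 3)) -expnMn leq_exp2r ?muln_gt0 // double_pred_expn.
have [S SA SP] := short_spanning_set K0 nU Kp KM.
exists #|S|; split; last first.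
  apply: leq_trans (no_unique_sum_bound A0 nU SP) _.
  have [->|S0] := posnP #|S|; first by rewrite !expn0.
  by rewrite leq_exp2r //; lia.
(* The exceptional elements contribute [9 * K ^ 5 + 162 * K ^ 9], at most [171 * K ^ 9] and hence at
   most [#|A|]. *)
apply: leq_trans SA _; rewrite (_ : 3 * #|A| = 2 * #|A| + #|A|); last by lia.
rewrite leq_add2l; apply: leq_trans Kn.
have -> : M = 3 * K ^ 4 by rewrite /M mulnCA -expnSr.
have -> : K * (3 * (3 * K ^ 4) + 18 * (3 * K ^ 4) ^ 2) = 9 * K ^ 5 + 162 * K ^ 9.
  by rewrite !expnS expn0; ring.
by have := pow 5 9 isT; lia.
Qed.
End Numerics.

From Stdlib Require Import Reals Lra.
(* Importing [Reals] last gives [%R] to the reals but takes [%N] away from [nat]. *)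
Delimit Scope nat_scope with N.

(** * Real logarithms and the growth of [omega] *)

Section Asymptotics.
Local Open Scope R_scope.

Lemma INR_expn m s : INR (expn m s) = (INR m ^ s)%R.
Proof. by elim: s => // s IH; rewrite expnS -multE mult_INR IH. Qed.

Lemma leq_INR m n : (m <= n)%N -> INR m <= INR n.
Proof. by move=> /ssrnat.leP; apply: le_INR. Qed.

Lemma ln_le_mono x y : 0 < x -> x <= y -> ln x <= ln y.
Proof. by move=> x0 [/(ln_increasing _ _ x0)|->]; [left | right]. Qed.

Lemma ln_le_id x : 0 < x -> ln x <= x.
Proof. by move=> x0; have := exp_ineq1_le (ln x); rewrite exp_ln //; lra. Qed.

Lemma ln_le_sqrt x : 0 < x -> ln x <= 2 * sqrt x.
Proof.
move=> x0; have s0 := sqrt_lt_R0 x x0; rewrite -{1}(sqrt_sqrt x); last by lra.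
by rewrite ln_mult //; have := ln_le_id s0; lra.
Qed.

Lemma ln_INR_expn p m s : (0 < p)%N -> (p <= expn m s)%N -> (0 < m)%N ->
  ln (INR p) <= INR s * ln (INR m).
Proof.
move=> p0 pm m0; have m0' : 0 < INR m by apply: lt_0_INR; apply/ssrnat.ltP.
rewrite -ln_pow // -INR_expn; apply: ln_le_mono; last exact: leq_INR.
by apply: lt_0_INR; apply/ssrnat.ltP.
Qed.

(** [A] spans itself with norm 1, so [pG G] is at most [5 ^ #|A|]; then [ln 5 <= 5]. *)
Lemma ln_pG_bound (G : finZmodType) (A : {set G}) : (1 < #|G|)%N ->
  A != set0 -> ~ has_unique_sum A -> ln (INR (pG G)) <= 5 * INR #|A|.
Proof.
move=> G1 A0 nU; have p0 : (0 < pG G)%N by apply: pdiv_gt0.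
have := no_unique_sum_bound A0 nU (@span_gen _ A); rewrite muln1 => /(ln_INR_expn p0)/(_ isT).
have : ln (INR 5) <= INR 5 by apply: ln_le_id; apply: lt_0_INR; apply/ssrnat.ltP.
have -> : INR 5 = 5 by rewrite /=; lra.
by have := pos_INR #|A|; nra.
Qed.

(** The bound [ln p <= s * ln (16 * K + 13)] with [s <= 3 * n / K] and
    [ln (16 * K + 13) <= 10 * sqrt K] gives [n >= sqrt K * ln p / 30]. The linear bound gives
    [K >= ln (ln p) / 2], and the threshold 500 ensures [K >= 128]. *)
Lemma sqrt_lnln_bound (G : finZmodType) (A : {set G}) : (1 < #|G|)%N ->
  A != set0 -> ~ has_unique_sum A -> 500 < ln (ln (INR (pG G))) ->
  sqrt (ln (ln (INR (pG G)))) / 60 * ln (INR (pG G)) <= INR #|A|.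
Proof.
move=> G1 A0 nU; have := ln_pG_bound G1 A0 nU.
have p1 : (1 < pG G)%N by apply/prime_gt1/pdiv_prime.
have n0 : (0 < #|A|)%N by rewrite card_gt0.
have core := pG_leq_expn A0 nU; move: core.
set K := (trunc_log 2 #|A|).+1; set p := pG G in p1 *; set n := #|A| in n0 *.
set l := ln (INR p); set x := ln l => core ln5 x500.
have l0 : 0 < l by rewrite -ln_1; apply: ln_increasing; [lra | apply: (lt_INR 1); apply/ssrnat.ltP].
have n0' : 0 < INR n by apply: lt_0_INR; apply/ssrnat.ltP.
have xn : x <= 5 + ln (INR n).
  have : x <= ln (5 * INR n) by apply: ln_le_mono.
  by rewrite ln_mult ?(ln_le_id 5); have := @ln_le_id 5; lra.
have nK : ln (INR n) <= INR K.
  have : (n <= expn 2 K)%N by apply: ltnW; rewrite trunc_log_ltn.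
  move=> /(ln_INR_expn n0)/(_ isT); rewrite (_ : INR 2 = 2) //.
  have : ln 2 < 1 by rewrite -[1]ln_exp; apply: ln_increasing; [lra | have := exp_ineq1 1; lra].
  by have := pos_INR K; nra.
clearbody K; have xK : x / 2 <= INR K by lra.
have K128 : (128 <= K)%N.
  rewrite leqNgt; apply/negP => /ssrnat.ltP/lt_INR; rewrite (_ : INR 128 = 128); first by lra.
  by rewrite INR_IZR_INZ.
have [s [Ks ps]] := core K128.
have K0 : 0 < INR K by lra.
have Ks' : INR K * INR s <= 3 * INR n.
  by have := leq_INR Ks; rewrite -!multE !mult_INR /=; lra.
have ls : l <= INR s * (10 * sqrt (INR K)).
  apply: Rle_trans (ln_INR_expn (ltnW p1) ps _) _; first by rewrite addn_gt0 orbT.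
  apply: Rmult_le_compat_l; first exact: pos_INR.
  have -> : INR (16 * K + 13) = 16 * INR K + 13.
    by rewrite -plusE -multE plus_INR mult_INR !INR_IZR_INZ.
  have -> : 10 * sqrt (INR K) = 2 * sqrt (25 * INR K).
    have s25 : sqrt 25 = 5 by rewrite -[RHS]sqrt_square; [congr sqrt|]; lra.
    by rewrite sqrt_mult ?s25; lra.
  by apply: Rle_trans (ln_le_mono _ _) (ln_le_sqrt _); lra.
have sx : sqrt x <= 2 * sqrt (INR K).
  rewrite -(sqrt_square 2); last by lra.
  by rewrite -sqrt_mult; [apply: sqrt_le_1_alt; lra | lra | lra].
have sK := sqrt_lt_R0 _ K0; have sKK := sqrt_sqrt _ (Rlt_le _ _ K0).
have : sqrt (INR K) * l <= 30 * INR n.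
  apply: Rle_trans (_ : sqrt (INR K) * (INR s * (10 * sqrt (INR K))) <= _).
    by apply: Rmult_le_compat_l; lra.
  nra.
nra.
Qed.

Lemma INR_large Y : exists N : nat, forall n : nat, (N <= n)%N -> Y <= INR n.
Proof.
have [N NY] := INR_unbounded Y; exists N => n /leq_INR; lra.
Qed.

Lemma lnln_large Y : exists N : nat, forall n : nat, (N <= n)%N -> Y <= ln (ln (INR n)).
Proof.
have [N NY] := INR_large (exp (exp Y)); exists N => n /NY le.
rewrite -[Y]ln_exp; apply: ln_le_mono; first exact: exp_pos.
by rewrite -[exp Y]ln_exp; apply: ln_le_mono => //; apply: exp_pos.
Qed.

End Asymptotics.

Theorem theorem1p5 :
  exists (omega : nat -> R) (c : R),
    (forall n : nat, (0 < omega n)%R) /\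
    (forall M : R, exists N : nat, forall n : nat, (N <= n)%N -> (M <= omega n)%R) /\
    (0 < c)%R /\
    (exists N : nat, forall n : nat, (N <= n)%N ->
       (c * sqrt (ln (ln (ln (INR n)))) / ln (ln (ln (ln (INR n)))) <= omega n)%R) /\
    (forall (G : finZmodType) (A : {set G}),
       1 < #|G| -> A != set0 -> ~ has_unique_sum A ->
       (omega (pG G) * ln (INR (pG G)) <= INR #|A|)%R).
Proof.
pose lnln n := ln (ln (INR n)).
(* Below the threshold the value 1/5 comes from [ln_pG_bound]. *)
pose omega n := if Rlt_dec 500 (lnln n) then (sqrt (lnln n) / 60)%R else (/ 5)%R.
exists omega, (/ 60)%R; split; [|split; [|split; [lra|split]]].
- move=> n; rewrite /omega; destruct (Rlt_dec 500 (lnln _)) as [n500|no]; rewrite /=; last by lra.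
  have n0 : (0 < lnln n)%R by lra.
  by have := sqrt_lt_R0 _ n0; lra.
- move=> M; have [N NP] := lnln_large (501 + (60 * M) * (60 * M))%R.
  exists N => n /NP; rewrite -/(lnln n) => le; rewrite /omega.
  destruct (Rlt_dec 500 (lnln _)) as [n500|no]; rewrite /=; last by nra.
  have : (sqrt ((60 * M) * (60 * M)) <= sqrt (lnln n))%R by apply: sqrt_le_1_alt; lra.
  by rewrite sqrt_Rsqr_abs; have := Rle_abs (60 * M)%R; lra.
(* From here on the fourfold logarithm is at least 1, so dividing by it only helps; 501 selects the
   first branch of [omega]. *)
- have [N NP] := lnln_large (501 + exp (exp 1))%R.
  exists N => n /NP; rewrite -/(lnln n) => le; rewrite /omega.
  have e0 := exp_pos (exp 1); destruct (Rlt_dec 500 (lnln _)) as [n500|no]; rewrite /=; last by lra.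
  set x := lnln n in le n500 *.
  have lx : (exp 1 <= ln x)%R by rewrite -[exp 1]ln_exp; apply: ln_le_mono; lra.
  have e1 := exp_pos 1.
  have llx : (1 <= ln (ln x))%R by rewrite -[X in (X <= _)%R]ln_exp; apply: ln_le_mono.
  have lxx : (sqrt (ln x) <= sqrt x)%R by apply/sqrt_le_1_alt/ln_le_id; lra.
  have s0 := sqrt_pos (ln x).
  apply: (Rle_trans _ (/ 60 * sqrt (ln x) / 1)); last by lra.
  apply: Rmult_le_compat_l; first by lra.
  by apply: Rinv_le_contravar; lra.
- move=> G A G1 A0 nU; rewrite /omega; destruct (Rlt_dec 500 (lnln _)) as [n500|no]; rewrite /=.
    exact: sqrt_lnln_bound.
  apply: (Rmult_le_reg_l 5); first by lra.
  rewrite -Rmult_assoc Rinv_r; last by lra.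
  by rewrite Rmult_1_l; apply: ln_pG_bound.
Qed.
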